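(* Let $T$ be a tree and let $P_k$ be a path in $T$ with vertex sequence $v_1,v_2,\dots,v_k$ ($k\geq 2$) such that all the interior vertices $v_2,\dots,v_{k-1}$ have degree two in $T$. Let $H_1$ (containing $v_1$) and $H_2$ (containing $v_k$) be the two trees obtained from $T$ by removing all the edges and interior vertices of $P_k$, and let $T':=(H_1:H_2):P_k$ be the generalized tree shift of $T$ with respect to $P_k$. Then $$f(T)-f(T')=y\cdot g_{v_1}(H_1)\cdot g_{v_k}(H_2)\cdot g_{v_1}(P_k).$$ Consequently, $f(T')\leq f(T)$, i.e. all coefficients of $f(T)-f(T')$ are non-negative.
   Context: **Graphs and Tutte polynomial.** A graph is a finite undirected graph, possibly with parallel edges and loops. The Tutte polynomial $\mathbf{T}_G(x,y)\in\mathbb{Z}[x,y]$ of a graph $G$ is defined recursively by: $\mathbf{T}_G=1$ if $G$ has no edges; and for an edge $e$ of $G$, $\mathbf{T}_G=\mathbf{T}_{G\setminus e}+\mathbf{T}_{G/e}$ if $e$ is neither a loop nor a bridge, $\mathbf{T}_G=y\,\mathbf{T}_{G\setminus e}$ if $e$ is a loop, $\mathbf{T}_G=x\,\mathbf{T}_{G/e}$ if $e$ is a bridge. Here $G\setminus e$ and $G/e$ denote deletion and contraction of $e$ (contraction keeps any resulting parallel edges and loops). **Cone, $f$ and $g_v$.** The cone $\mathrm{Cone}(G)$ over a graph $G$ is obtained from $G$ by adding one extra vertex $r$ (the apex) and connecting $r$ to each vertex of $G$ by one edge. Define $f(G):=\mathbf{T}_{\mathrm{Cone}(G)}(1,y)\in\mathbb{Z}[y]$.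 For a vertex $v$ of $G$, let $\varepsilon(v)$ be the edge of $\mathrm{Cone}(G)$ connecting $v$ and $r$, and define $$g_v(G):=\begin{cases}\mathbf{T}_{\mathrm{Cone}(G)\setminus\varepsilon(v)}(1,y), & \text{if } v \text{ is adjacent to some other vertex of } G,\\ 0, & \text{otherwise.}\end{cases}$$ **1-sum and generalized tree shift.** If $G_1,G_2$ are graphs with distinguished vertices $w_1,w_2$ respectively, $G_1:G_2$ is the graph obtained from the disjoint union of $G_1$ and $G_2$ by identifying $w_1$ with $w_2$. In $T'=(H_1:H_2):P_k$, the distinguished vertex of $H_1$ is $v_1$ and that of $H_2$ is $v_k$ (these are identified to form $H_1:H_2$), and then this identified vertex of $H_1:H_2$ is identified with the end vertex $v_k$ of the path $P_k$. In $g_{v_1}(P_k)$, $P_k$ is regarded as a graph on its own (the path on the $k$ vertices $v_1,\dots,v_k$ in order). *)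

(* Defs.v *)
From HB Require Import structures.
From mathcomp Require Import all_boot all_order all_algebra.

Set Implicit Arguments.
Unset Strict Implicit.
Unset Printing Implicit Defensive.

Import Order.TTheory GRing.Theory Num.Theory.
Local Open Scope ring_scope.

(* Finite undirected multigraphs, with loops and parallel edges.  The order of
   the two ends of an edge is an artefact of the encoding: every notion below
   is insensitive to it. *)
Record mgraph := MGraph {
  vertex : finType;
  edge : finType;
  src : edge -> vertex;
  tgt : edge -> vertex }.

Section Basics.
Variable G : mgraph.
Implicit Types (u v x : vertex G) (e : edge G) (F : {set edge G}).

Definition joins e u v : bool :=
  ((src e == u) && (tgt e == v)) || ((src e == v) && (tgt e == u)).

Definition adj_in F u v : bool := [exists e in F, joins e u v].

Definition adj u v : bool := adj_in [set: edge G] u v.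

Definition loop e : bool := src e == tgt e.

Definition bridge e : bool := ~~ connect (adj_in [set~ e]) (src e) (tgt e).

(* A loop counts twice. *)
Definition degree v : nat :=
  #|[set e | src e == v]| + #|[set e | tgt e == v]|.

Definition connected : Prop :=
  (0 < #|vertex G|)%N /\ forall u v, connect adj u v.

(* Cycles have length n.+1; length 1 is a loop and length 2 is a pair of
   parallel edges.  [ordS] is the successor modulo n.+1. *)
Definition acyclic : Prop :=
  forall n (c : 'I_n.+1 -> vertex G) (d : 'I_n.+1 -> edge G),
    injective c -> injective d ->
    ~ (forall i, joins (d i) (c i) (c (ordS i))).

Definition is_tree : Prop := connected /\ acyclic.

Definition del e : mgraph :=
  @MGraph (vertex G) {d : edge G | d != e}
    (fun d => src (val d)) (fun d => tgt (val d)).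

(* Contraction of e: its end [tgt e] is merged into [src e].  For a loop the
   vertex predicate is always true, and contraction amounts to deletion. *)
Definition merge e x : vertex G := if x == tgt e then src e else x.

Lemma merge_subproof e x : (merge e x == src e) || (merge e x != tgt e).
Proof. by rewrite /merge; case: (eqVneq x (tgt e)) => [_|->]; rewrite ?eqxx ?orbT. Qed.

Definition contract e : mgraph :=
  @MGraph {x : vertex G | (x == src e) || (x != tgt e)} {d : edge G | d != e}
    (fun d => exist _ (merge e (src (val d))) (merge_subproof e _))
    (fun d => exist _ (merge e (tgt (val d))) (merge_subproof e _)).

Definition cone : mgraph :=
  @MGraph (option (vertex G)) (edge G + vertex G)%type
    (fun a => match a with inl e => Some (src e) | inr v => Some v end)
    (fun a => match a with inl e => Some (tgt e) | inr _ => None end).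

Lemma component_src_subproof F x
    (d : {e : edge G | (e \in F) && connect (adj_in F) x (src e)}) :
  connect (adj_in F) x (src (val d)).
Proof. by case/andP: (valP d). Qed.

Lemma component_tgt_subproof F x
    (d : {e : edge G | (e \in F) && connect (adj_in F) x (src e)}) :
  connect (adj_in F) x (tgt (val d)).
Proof.
case/andP: (valP d) => eF /connect_trans; apply; apply: connect1.
by apply/existsP; exists (val d); rewrite eF /joins !eqxx.
Qed.

(* The component of x in the spanning subgraph of G with edge set F. *)
Definition component F x : mgraph :=
  @MGraph {u : vertex G | connect (adj_in F) x u}
    {e : edge G | (e \in F) && connect (adj_in F) x (src e)}
    (fun d => exist _ (src (val d)) (component_src_subproof d))
    (fun d => exist _ (tgt (val d)) (component_tgt_subproof d)).

Definition component_root F x : vertex (component F x) :=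
  exist _ x (connect0 (adj_in F) x).

End Basics.

(* Z[x,y] is {poly {poly int}}, with x := 'X and y := 'X%:P.  The recursion
   always terminates within #|edge G| steps; it expands along an arbitrarily
   picked edge, the result being classically independent of that choice. *)
Fixpoint tutte_rec (n : nat) (G : mgraph) : {poly {poly int}} :=
  if n is n'.+1 then
    if [pick e : edge G] is Some e then
      if loop e then 'X%:P * tutte_rec n' (del e)
      else if bridge e then 'X * tutte_rec n' (contract e)
      else tutte_rec n' (del e) + tutte_rec n' (contract e)
    else 1
  else 1.

Definition tutte (G : mgraph) : {poly {poly int}} := tutte_rec #|edge G| G.

(* The specialisation T_G(1,y). *)
Definition tutte1 (G : mgraph) : {poly int} := (tutte G).[1].

Definition f (G : mgraph) : {poly int} := tutte1 (cone G).

Definition g (G : mgraph) (v : vertex G) : {poly int} :=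
  if [exists u, (u != v) && adj v u]
  then tutte1 (@del (cone G) (inr v)) else 0.

(* In the 1-sum, w2 is represented by w1. *)
Definition onesum_inr (G1 G2 : mgraph) (w1 : vertex G1) (w2 x : vertex G2) :
    vertex G1 + {x : vertex G2 | x != w2} :=
  if insub x is Some u then inr u else inl w1.

Definition onesum (G1 : mgraph) (w1 : vertex G1) (G2 : mgraph)
    (w2 : vertex G2) : mgraph :=
  @MGraph (vertex G1 + {x : vertex G2 | x != w2})%type
    (edge G1 + edge G2)%type
    (fun a => match a with
              | inl e => inl (src e)
              | inr e => onesum_inr w1 w2 (src e)
              end)
    (fun a => match a with
              | inl e => inl (tgt e)
              | inr e => onesum_inr w1 w2 (tgt e)
              end).

Definition onesum_pt (G1 : mgraph) (w1 : vertex G1) (G2 : mgraph)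
    (w2 : vertex G2) : vertex (onesum w1 w2) := inl w1.

(* The path with n edges, hence n.+1 vertices. *)
Definition path_graph (n : nat) : mgraph :=
  @MGraph 'I_n.+1 'I_n (widen_ord (leqnSn n)) (lift ord0).

(* A path v_1, ..., v_k is given by v : nat -> vertex T; only the values at
   1, ..., k are relevant. *)
Section TreeShift.
Variables (T : mgraph) (k : nat) (v : nat -> vertex T).

Definition is_path : Prop :=
  (forall i j, (1 <= i <= k)%N -> (1 <= j <= k)%N -> v i = v j -> i = j) /\
  (forall i, (1 <= i < k)%N -> adj (v i) (v i.+1)).

Definition path_edges : {set edge T} :=
  [set e | [exists i : 'I_k, (0 < i)%N && joins e (v i) (v i.+1)]].

Definition path_interior : {set vertex T} :=
  [set x | [exists i : 'I_k, (1 < i)%N && (x == v i)]].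

(* The edges that remain after removing the edges and the interior vertices
   of the path. *)
Definition remaining_edges : {set edge T} :=
  [set e | [&& e \notin path_edges, src e \notin path_interior
             & tgt e \notin path_interior]].

Definition H1 : mgraph := component remaining_edges (v 1%N).
Definition H1_root : vertex H1 := component_root remaining_edges (v 1%N).
Definition H2 : mgraph := component remaining_edges (v k).
Definition H2_root : vertex H2 := component_root remaining_edges (v k).

(* (H_1 : H_2) : P_k, where the vertices v_1 and v_k of P_k are ord0 and
   ord_max in [path_graph k.-1]. *)
Definition tree_shift : mgraph :=
  @onesum (onesum H1_root H2_root) (onesum_pt H1_root H2_root)
    (path_graph k.-1) ord_max.

End TreeShift.

(* Main.v *)
Require Import Defs.
From HB Require Import structures.
From mathcomp Require Import all_boot all_order all_algebra.
From mathcomp Require Import ring zify.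

(** Put q = y - 1.  At x = 1 the Tutte polynomial of a connected graph G
    enumerates its connected spanning edge sets: q^(|V| - 1) T_G(1, y) is the
    sum of q^|A| over the edge sets A that connect all of G
    ([tutte1_span_sum]); deletion-contraction of e is the splitting of this sum
    according to whether e belongs to A.

    For a graph G rooted at w, the proof follows two such sums over the cone of
    G deprived of its spoke at w: C, over the edge sets that connect every
    vertex to the apex, and D, over those that connect every vertex to the apex
    or to w.  They recover both invariants, since q^|V| g_w(G) = C and
    q^|V| f(G) = C + q D ([g_rooted_cone], [f_rooted_cone]), and the pair (C, D)
    behaves well under the constructions at hand.  A 1-sum at the roots sends
    (C1, D1), (C2, D2) to (C1 D2 + D1 C2 - C1 C2, D1 D2) ([rooted_cone_glue]),
    and growing a pendant edge at the root, whose new end becomes the root, is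
    a linear map M ([rooted_cone_extend]).

    Let a and b be the pairs of H1 and H2, and n = k - 1.  Then T has the pair
    M^n a glued with b ([rooted_cone_tree]), and the tree shift has a glued with
    b glued with M^n (0, 1), where (0, 1) is the pair of a single vertex.  By
    Cayley-Hamilton M^n = u + z M for some scalars u and z.  Expanding, all
    terms of the difference of the two values of C + q D cancel except
    y z C1 C2, whereas the first coordinate of M^n (0, 1), which is
    q^k g_{v_1}(P_k), is z q^2 ([close_cone_tree_shift]).  Since
    |V(T)| + 2 = |V(H1)| + |V(H2)| + k, the powers of q cancel and leave the
    identity.  Positivity is then read off the right-hand side, because the
    deletion-contraction recursion has non-negative coefficients.

    That T really is H1, a path and H2 glued in a row rests on two facts: every
    edge of an acyclic graph is a bridge, which separates H1 from H2, and an
    interior vertex of degree two meets no edge outside the path.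

    Connectivity is expressed throughout by stable vertex sets, those that no
    edge of A leaves: A connects U to S when every stable set containing S
    contains U.  Stable sets restrict to the pieces of a graph and glue back,
    so that walks occur only where bridges, components and cycles are compared
    with them. *)

Set Implicit Arguments.
Unset Strict Implicit.
Unset Printing Implicit Defensive.

Import Order.TTheory GRing.Theory Num.Theory.
Local Open Scope ring_scope.

(** * Sums over the subsets of a set *)

Section SubsetSums.
Variables (R : nmodType) (I : finType).
Implicit Types (A B K : {set I}) (h : {set I} -> R).

Lemma sum_subsetU K1 K2 h : [disjoint K1 & K2] ->
  \sum_(A : {set I} | A \subset K1 :|: K2) h A =
  \sum_(A : {set I} | A \subset K1)
    \sum_(B : {set I} | B \subset K2) h (A :|: B).
Proof.
move=> dis; rewrite pair_big /=.
rewrite (reindex_onto (fun p : {set I} * {set I} => p.1 :|: p.2)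
  (fun A => (A :&: K1, A :&: K2))) /=; last first.
  by move=> A /setIidPl; rewrite -setIUr.
apply: eq_bigl => -[A B] /=; apply/andP/andP => [[_ /eqP[<- <-]]|[AK BK]].
  by rewrite !subsetIr.
split; first exact: setUSS.
have := disjoint_setI0 dis => /setP K0.
apply/eqP; congr pair; apply/setP => x; move: (K0 x) (subsetP AK x) (subsetP BK x);
  rewrite !inE; case: (x \in A) (x \in B) (x \in K1) (x \in K2) => [] [] [] [] //= _ H H';
  by [have := H isT | have := H' isT].
Qed.

Lemma sum_subset1 (e : I) h :
  \sum_(A : {set I} | A \subset [set e]) h A = h set0 + h [set e].
Proof.
have n0 : set0 != [set e] by apply/eqP/setP=> /(_ e); rewrite !inE eqxx.
rewrite (bigD1 set0) ?sub0set //= (bigD1 [set e]) /= ?subxx 1?eq_sym //.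
rewrite big1 ?addr0 // => A /andP[/andP[]].
by rewrite subset1 => /orP[->|->].
Qed.

Lemma sum_subsetU1 e K h : e \notin K ->
  \sum_(A : {set I} | A \subset e |: K) h A =
  \sum_(A : {set I} | A \subset K) h A +
  \sum_(A : {set I} | A \subset K) h (e |: A).
Proof.
move=> eK; rewrite sum_subsetU ?sum_subset1 ?disjoints1 //.
by congr (_ + _); apply: eq_bigr => A _; rewrite set0U.
Qed.

End SubsetSums.

Lemma sum_subset_imset (R : nmodType) (I J : finType) (p : I -> J)
    (K : {set I}) (h : {set J} -> R) : injective p ->
  \sum_(B : {set J} | B \subset p @: K) h B =
  \sum_(A : {set I} | A \subset K) h (p @: A).
Proof.
move=> pI; rewrite (reindex_onto (fun A : {set I} => p @: A)
  (fun B => p @^-1: B)) /=; last first.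
  move=> B sB; apply/setP => x; apply/imsetP/idP => [[y + ->]|xB].
    by rewrite inE.
  by have /imsetP[y yK xE] := subsetP sB _ xB; exists y; rewrite ?inE -?xE.
apply: eq_bigl => A.
have -> : p @^-1: (p @: A) = A by apply/setP=> x; rewrite inE mem_imset.
rewrite eqxx andbT; apply/subsetP/subsetP => H x.
  by move=> xA; have := H (p x); rewrite !mem_imset //; apply.
by case/imsetP => y yA ->; rewrite mem_imset ?H.
Qed.

(** * Connectivity through stable vertex sets *)

Section Spanning.
Variable G : mgraph.
Implicit Types (U W S : {set vertex G}) (A B K : {set edge G}).
Implicit Types (e : edge G) (r w u x : vertex G).

Definition stable A W : bool := [forall e in A, (src e \in W) == (tgt e \in W)].

(** Every vertex of U is connected to S by edges of A: the vertices connected to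
    S form the least stable set that contains S. *)
Definition spans U A S : bool :=
  [forall W : {set vertex G}, stable A W ==> (S \subset W) ==> (U \subset W)].

Definition supported K U : bool :=
  [forall e in K, (src e \in U) && (tgt e \in U)].

Lemma stableP A W :
  reflect {in A, forall e, (src e \in W) = (tgt e \in W)} (stable A W).
Proof. by apply: (iffP forall_inP) => H e /H /eqP. Qed.

Lemma spansP U A S :
  reflect (forall W, stable A W -> S \subset W -> U \subset W) (spans U A S).
Proof.
apply: (iffP forallP) => H W; first by move=> st sS; move: (H W); rewrite st sS.
by apply/implyP=> st; apply/implyP; apply: H.
Qed.

Lemma supportedP K U :
  reflect {in K, forall e, src e \in U /\ tgt e \in U} (supported K U).
Proof. by apply: (iffP forall_inP) => H e /H /andP. Qed.

Lemma joins_endsP e u w :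
  reflect (src e = u /\ tgt e = w \/ src e = w /\ tgt e = u) (joins e u w).
Proof.
by apply: (iffP orP) => -[[]|[]] => [/andP[/eqP-> /eqP->]|/andP[/eqP-> /eqP->]|->->|->->];
  rewrite ?eqxx; auto.
Qed.

Lemma stableU1 e u w A W : joins e u w ->
  stable (e |: A) W = stable A W && ((u \in W) == (w \in W)).
Proof.
move=> jo; apply/stableP/andP => [H|[/stableP H uw] d].
  split; first by apply/stableP => d dA; apply: H; rewrite inE dA orbT.
  have := H e (setU11 _ _); case/joins_endsP: jo => -[-> ->] -> //.
rewrite !inE => /orP[/eqP->|/H //].
by case/joins_endsP: jo => -[-> ->]; rewrite (eqP uw).
Qed.

Lemma stable_sub A B W : B \subset A -> stable A W -> stable B W.
Proof. by move=> /subsetP BA /stableP H; apply/stableP=> e /BA /H. Qed.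

Lemma supported_sub A K U : A \subset K -> supported K U -> supported A U.
Proof. by move=> /subsetP BA /supportedP H; apply/supportedP=> e /BA /H. Qed.

Lemma spans_sub U A (S S' : {set vertex G}) : S \subset S' -> spans U A S -> spans U A S'.
Proof.
by move=> sS /spansP H; apply/spansP => W st /(subset_trans sS); apply: H.
Qed.

(** How stable sets pass from the pieces to the whole: each edge lies inside one
    piece, where membership in the union is decided by the set of that piece. *)
Lemma stable_glue U1 U2 A1 A2 W1 W2 : supported A1 U1 -> supported A2 U2 ->
  {in U1 :&: U2, W1 =i W2} -> stable A1 W1 -> stable A2 W2 ->
  stable (A1 :|: A2) ((W1 :&: U1) :|: (W2 :&: U2)).
Proof.
move=> /supportedP s1 /supportedP s2 agree /stableP st1 /stableP st2.
have m1 x : x \in U1 -> (x \in (W1 :&: U1) :|: (W2 :&: U2)) = (x \in W1).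
  move=> x1; rewrite !inE x1 andbT; case x2: (x \in U2); last by rewrite andbF orbF.
  by rewrite andbT -agree ?orbb // inE x1.
have m2 x : x \in U2 -> (x \in (W1 :&: U1) :|: (W2 :&: U2)) = (x \in W2).
  move=> x2; rewrite !inE x2 andbT; case x1: (x \in U1); last by rewrite andbF.
  by rewrite andbT agree ?orbb // inE x1.
apply/stableP => e; rewrite inE => /orP[eA|eA].
  by have [? ?] := s1 e eA; rewrite !m1 ?st1.
by have [? ?] := s2 e eA; rewrite !m2 ?st2.
Qed.

End Spanning.

(** * Enumeration of connecting edge sets; parallel and series composition *)

Section SpanSum.
Variables (R : comNzRingType) (q : R) (G : mgraph).
Implicit Types (U W S : {set vertex G}) (A B K : {set edge G}).
Implicit Types (e : edge G) (r w u x : vertex G).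

Definition span_sum U K S : R :=
  \sum_(A : {set edge G} | A \subset K) (spans U A S)%:R * q ^+ #|A|.

Lemma span_sum0 U S : span_sum U set0 S = (U \subset S)%:R.
Proof.
rewrite /span_sum (big_pred1 set0) => [|A]; last by rewrite subset0.
rewrite cards0 mulr1; congr (_%:R); congr nat_of_bool.
apply/spansP/idP => [H|US W _ SW]; last exact: subset_trans SW.
by apply: H => //; apply/stableP => e; rewrite inE.
Qed.

(** The edge sets containing e contribute a factor q.  The second sum is kept
    raw because adding e changes the connectivity in different ways, depending
    on where e lies. *)
Lemma span_sumU1 e U K S : e \notin K ->
  span_sum U (e |: K) S = span_sum U K S +
    q * \sum_(A : {set edge G} | A \subset K) (spans U (e |: A) S)%:R * q ^+ #|A|.
Proof.
move=> eK; rewrite /span_sum sum_subsetU1 //; congr (_ + _).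
rewrite mulr_sumr; apply: eq_bigr => A AK.
rewrite cardsU1 (contra (subsetP AK e)) //= exprS; ring.
Qed.

(** A stable set of the first piece that contains both terminals extends by all
    of the second piece. *)
Lemma spans_restrict r w U1 U2 A1 A2 : U1 :&: U2 = [set r; w] ->
  supported A1 U1 -> supported A2 U2 ->
  spans (U1 :|: U2) (A1 :|: A2) [set r; w] -> spans U1 A1 [set r; w].
Proof.
move=> U12 s1 s2 /spansP H; apply/spansP => W st /subsetP rw.
have st' : stable (A1 :|: A2) ((W :&: U1) :|: (setT :&: U2)).
  apply: stable_glue => // [x|]; first by rewrite U12 => /rw ->; rewrite inE.
  by apply/stableP => e _; rewrite !inE.
have rw' : [set r; w] \subset (W :&: U1) :|: (setT :&: U2).
  apply/subsetP => z; rewrite -U12 !inE => /andP[_ z2].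
  by rewrite z2 orbT.
apply/subsetP => x x1; have := subsetP (H _ st' rw') x.
rewrite !inE x1 andbT => /(_ isT) /orP[//|x2].
by apply: rw; rewrite -U12 inE x1.
Qed.

Section Parallel.
Variables (r w : vertex G) (U1 U2 : {set vertex G}) (K1 K2 : {set edge G}).
Hypotheses (U12 : U1 :&: U2 = [set r; w]) (K12 : [disjoint K1 & K2]).
Hypotheses (s1 : supported K1 U1) (s2 : supported K2 U2).

Lemma spans_parallel2 A1 A2 : A1 \subset K1 -> A2 \subset K2 ->
  spans (U1 :|: U2) (A1 :|: A2) [set r; w] =
  spans U1 A1 [set r; w] && spans U2 A2 [set r; w].
Proof.
move=> AK1 AK2.
have sA1 := supported_sub AK1 s1; have sA2 := supported_sub AK2 s2.
apply/idP/andP => [sp|[/spansP H1 /spansP H2]].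
  split; first exact: spans_restrict U12 sA1 sA2 sp.
  apply: (@spans_restrict r w U2 U1 A2 A1) => //; first by rewrite setIC.
  by rewrite setUC [A2 :|: A1]setUC.
apply/spansP => W st rw; rewrite subUset H1 ?H2 //;
  apply: stable_sub st; by rewrite ?subsetUl ?subsetUr.
Qed.

(** The terminal w must reach r through one of the two pieces; in the other
    piece it then serves as a second source.  If neither piece connected w to r,
    stable sets witnessing this would both avoid w, hence agree on the
    terminals and glue to a stable set avoiding w. *)
Lemma spans_parallel1 A1 A2 : A1 \subset K1 -> A2 \subset K2 ->
  spans (U1 :|: U2) (A1 :|: A2) [set r] =
  (spans U1 A1 [set r] && spans U2 A2 [set r; w]) ||
  (spans U1 A1 [set r; w] && spans U2 A2 [set r]).
Proof.
move=> AK1 AK2.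
have sub2 : [set r] \subset [set r; w] by rewrite sub1set !inE eqxx.
have mrw : {subset [set r; w] <= U1 :&: U2} by rewrite U12.
have [r1 r2] : r \in U1 /\ r \in U2.
  by apply/andP; rewrite -in_setI mrw // !inE eqxx.
have [w1 w2] : w \in U1 /\ w \in U2.
  by apply/andP; rewrite -in_setI mrw // !inE eqxx orbT.
apply/idP/idP => [sp|].
- have := spans_sub sub2 sp; rewrite spans_parallel2 // => /andP[S1 S2].
  rewrite S1 S2 andbT /=; apply/norP => -[/negP N1 /negP N2].
  apply: N1; apply/spansP => W1 st1 rW1; apply/negPn/negP => n1.
  apply: N2; apply/spansP => W2 st2 rW2; apply/negPn/negP => n2.
  have {n1} wW1 : w \notin W1.
    apply: contra n1 => wW; apply: (spansP _ _ _ S1) => //.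
    by rewrite subUset rW1 sub1set.
  have {n2} wW2 : w \notin W2.
    apply: contra n2 => wW; apply: (spansP _ _ _ S2) => //.
    by rewrite subUset rW2 sub1set.
  have st : stable (A1 :|: A2) ((W1 :&: U1) :|: (W2 :&: U2)).
    apply: stable_glue => //; try exact: supported_sub s1; try exact: supported_sub s2.
    move=> x; rewrite U12 !inE => /orP[]/eqP->; rewrite ?(negPf wW1) ?(negPf wW2) //.
    by move: rW1 rW2; rewrite !sub1set => -> ->.
  have := subsetP (spansP _ _ _ sp _ st _) w; rewrite sub1set !inE r1 w1 w2.
  rewrite (negPf wW1) (negPf wW2) -sub1set rW1 /=; by move=> /(_ isT isT).
- case/orP => /andP[/spansP S1 /spansP S2]; apply/spansP => W st rW.
    have W1 : U1 \subset W by apply: S1 => //; apply: stable_sub st; exact: subsetUl.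
    rewrite subUset W1; apply: S2; first by apply: stable_sub st; exact: subsetUr.
    by rewrite subUset rW sub1set (subsetP W1).
  have W2 : U2 \subset W by apply: S2 => //; apply: stable_sub st; exact: subsetUr.
  rewrite subUset W2 andbT; apply: S1; first by apply: stable_sub st; exact: subsetUl.
  by rewrite subUset rW sub1set (subsetP W2).
Qed.

Lemma span_sum_parallel2 :
  span_sum (U1 :|: U2) (K1 :|: K2) [set r; w] =
  span_sum U1 K1 [set r; w] * span_sum U2 K2 [set r; w].
Proof.
rewrite /span_sum sum_subsetU // mulr_suml; apply: eq_bigr => A1 A1K.
rewrite mulr_sumr; apply: eq_bigr => A2 A2K.
rewrite spans_parallel2 // cardsU disjoint_setI0 ?cards0 ?subn0; last first.
  by apply: disjointW K12.
by rewrite exprD -mulnb natrM; ring.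
Qed.

(** Inclusion-exclusion on the disjunction of [spans_parallel1]. *)
Lemma span_sum_parallel1 :
  span_sum (U1 :|: U2) (K1 :|: K2) [set r] =
  span_sum U1 K1 [set r] * span_sum U2 K2 [set r; w] +
  span_sum U1 K1 [set r; w] * span_sum U2 K2 [set r] -
  span_sum U1 K1 [set r] * span_sum U2 K2 [set r].
Proof.
rewrite /span_sum sum_subsetU // !mulr_suml -big_split -sumrB /=.
apply: eq_bigr => A1 A1K.
rewrite !mulr_sumr -big_split -sumrB /=; apply: eq_bigr => A2 A2K.
rewrite spans_parallel1 // cardsU disjoint_setI0 ?cards0 ?subn0; last first.
  by apply: disjointW K12.
have sub2 : [set r] \subset [set r; w] by rewrite sub1set !inE eqxx.
move: (@spans_sub _ U1 A1 _ _ sub2) (@spans_sub _ U2 A2 _ _ sub2); rewrite exprD.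
by case: (spans U1 A1 [set r]) (spans U2 A2 [set r]) (spans U1 A1 [set r; w]) (spans U2 A2 [set r; w])
  => [] [] [] [] H1 H2 /=; first [by have := H1 isT | by have := H2 isT | ring].
Qed.

End Parallel.

(** An edge between the terminals makes them a single source. *)
Lemma span_sum_edge1 r w e U K : joins e r w -> e \notin K ->
  span_sum U (e |: K) [set r] =
  span_sum U K [set r] + q * span_sum U K [set r; w].
Proof.
move=> jo eK; rewrite span_sumU1 //; congr (_ + q * _).
apply: eq_bigr => A _; congr (_%:R * _); congr nat_of_bool.
apply/spansP/spansP => H W.
  rewrite subUset !sub1set => st /andP[rW wW]; apply: H; rewrite ?sub1set //.
  by rewrite (stableU1 _ _ jo) st rW wW.
rewrite (stableU1 _ _ jo) sub1set => /andP[st /eqP rw] rW; apply: H => //.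
by rewrite subUset !sub1set -rw rW.
Qed.

Lemma span_sum_edge2 r w e U K : joins e r w -> e \notin K ->
  span_sum U (e |: K) [set r; w] = (1 + q) * span_sum U K [set r; w].
Proof.
move=> jo eK; rewrite span_sumU1 // mulrDl mul1r; congr (_ + q * _).
apply: eq_bigr => A _; congr (_%:R * _); congr nat_of_bool.
apply/spansP/spansP => H W.
  rewrite subUset !sub1set => st /andP[rW wW]; apply: H.
    by rewrite (stableU1 _ _ jo) st rW wW.
  by rewrite subUset !sub1set rW.
by rewrite (stableU1 _ _ jo) => /andP[st _]; apply: H.
Qed.

Section Pendant.
Variables (r w x : vertex G) (e : edge G) (U : {set vertex G}) (K : {set edge G}).
Hypotheses (jo : joins e w x) (eK : e \notin K) (xU : x \notin U).
Hypotheses (rU : r \in U) (wU : w \in U) (sK : supported K U).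

Let supp1 : supported [set e] [set w; x].
Proof.
by apply/supportedP => d /set1P ->; case/joins_endsP: jo => -[-> ->]; rewrite !inE !eqxx orbT.
Qed.

Lemma spans_pendant_in A S : A \subset K -> S \subset U ->
  spans (x |: U) (e |: A) S = spans U A S.
Proof.
move=> AK SU; have sA := supported_sub AK sK.
apply/spansP/spansP => H W st SW; last first.
  move: st; rewrite (stableU1 _ _ jo) => /andP[st /eqP wx].
  have UW := H _ st SW; rewrite subUset UW sub1set -wx (subsetP UW) //.
(* The new vertex x has to be put on the side of w. *)
pose W2 := if w \in W then setT else set0 : {set vertex G}.
have m2 z : (z \in W2) = (w \in W) by rewrite /W2; case: ifP; rewrite inE.
have st2 : stable [set e] W2 by apply/stableP => d _; rewrite !m2.
have st' : stable (e |: A) ((W :&: U) :|: (W2 :&: [set w; x])).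
  rewrite setUC; apply: stable_glue => // y; rewrite !inE m2.
  by case/andP=> yU /orP[/eqP->//|/eqP yx]; case/negP: xU; rewrite -yx.
have S' : S \subset (W :&: U) :|: (W2 :&: [set w; x]).
  by apply/subsetP => y yS; rewrite !inE (subsetP SW _ yS) (subsetP SU _ yS).
have UW := subsetP (H _ st' S').
apply/subsetP => z zU; have zx : z != x by apply: contraNneq xU => <-.
have := UW z; rewrite !inE zU m2 andbT orbT (negPf zx) orbF => /(_ isT).
by case/orP => [//|/andP[? /eqP ->]].
Qed.

Lemma spans_pendant_out A S : A \subset K ->
  spans (x |: U) A (x |: S) = spans U A S.
Proof.
move=> AK; have sA := supported_sub AK sK.
apply/spansP/spansP => H W st SW; last first.
  move: SW; rewrite !subUset => /andP[-> SW]; exact: H.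
have st' : stable A (x |: W).
  apply/stableP => d dA; rewrite !inE (stableP _ _ st) //.
  have [sU tU] := supportedP _ _ sA d dA.
  have -> : (src d == x) = false by apply: contraNF xU => /eqP <-.
  by have -> : (tgt d == x) = false by apply: contraNF xU => /eqP <-.
have := H _ st' (setUS _ SW); rewrite subUset => /andP[_ /subsetP UW].
apply/subsetP => z zU; have := UW _ zU; rewrite !inE => /orP[/eqP zx|//].
by case/negP: xU; rewrite -zx.
Qed.

(** Without e, the new vertex is cut off from r. *)
Lemma span_sum_pendant1 :
  span_sum (x |: U) (e |: K) [set r] = q * span_sum U K [set r].
Proof.
rewrite span_sumU1 // [X in X + _]big1 ?add0r => [|A AK].
  congr (q * _); apply: eq_bigr => A AK; rewrite spans_pendant_in // sub1set //.
suff /negPf-> : ~~ spans (x |: U) A [set r] by rewrite mul0r.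
apply/spansP => /(_ [set~ x]); rewrite subUset !sub1set !inE eqxx /= => H.
suff: false by []; apply: H; last by apply: contraNneq xU => <-.
apply/stableP => d dA; have [sU tU] := supportedP _ _ sK d (subsetP AK d dA).
rewrite !inE; have -> : (src d == x) = false by apply: contraNF xU => /eqP <-.
by have -> : (tgt d == x) = false by apply: contraNF xU => /eqP <-.
Qed.

(** With x itself a source, an edge set avoiding e must work inside U, while e
    turns w into a source. *)
Lemma span_sum_pendant2 :
  span_sum (x |: U) (e |: K) [set r; x] =
  span_sum U K [set r] + q * span_sum U K [set r; w].
Proof.
rewrite span_sumU1 //; congr (_ + q * _); apply: eq_bigr => A AK;
  congr (_%:R * _); congr nat_of_bool.
  by rewrite [[set r; x]]setUC spans_pendant_out.
rewrite -(spans_pendant_in AK) ?subUset ?sub1set ?rU //.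
by apply/spansP/spansP => H W st; have := st; rewrite (stableU1 _ _ jo) => /andP[_ /eqP wx];
  have := H W st; rewrite !subUset !sub1set wx.
Qed.

End Pendant.
End SpanSum.

(** * Transport along embeddings *)

Definition embedding (G G' : mgraph) (p : vertex G -> vertex G')
    (d : edge G -> edge G') : Prop :=
  [/\ injective p, injective d & forall e, joins (d e) (p (src e)) (p (tgt e))].

Section Embedding.
Variables (G G' : mgraph) (p : vertex G -> vertex G') (d : edge G -> edge G').
Hypothesis emb : embedding p d.

Lemma spans_embedding (U S : {set vertex G}) (A : {set edge G}) :
  spans (p @: U) (d @: A) (p @: S) = spans U A S.
Proof.
have [pI dI jo] := emb.
have st W : stable (d @: A) W = stable A (p @^-1: W).
  apply/stableP/stableP => H e.
    move=> eA; have := H (d e); rewrite mem_imset // !inE => /(_ eA).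
    by have /joins_endsP[[-> ->]|[-> ->]] := jo e => ->.
  case/imsetP => e' eA ->; have := H e' eA; rewrite !inE.
  by have /joins_endsP[[-> ->]|[-> ->]] := jo e' => ->.
apply/spansP/spansP => H W.
  move=> stW SW; have pW : p @^-1: (p @: W) = W.
    by apply/setP=> x; rewrite inE mem_imset.
  have := H (p @: W); rewrite st pW imsetS // => /(_ stW isT) /subsetP UW.
  by apply/subsetP => x xU; have := UW (p x); rewrite !mem_imset //; apply.
by rewrite st !sub_imset_pre; apply: H.
Qed.

Lemma span_sum_embedding (R : comNzRingType) (q : R) (U S : {set vertex G})
    (K : {set edge G}) :
  span_sum q (p @: U) (d @: K) (p @: S) = span_sum q U K S.
Proof.
have [pI dI _] := emb; rewrite /span_sum sum_subset_imset //.
by apply: eq_bigr => A _; rewrite spans_embedding card_imset.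
Qed.

End Embedding.

(** * The Tutte polynomial at x = 1 *)

Lemma del_embedding (G : mgraph) (e : edge G) :
  @embedding (del e) G id (fun d => val d).
Proof. by split=> [|x y /val_inj|d] //; apply/joins_endsP; left. Qed.

Lemma imset_val_del (G : mgraph) (e : edge G) :
  [set val d | d in [set: edge (del e)]] = [set~ e].
Proof.
apply/setP => d; rewrite !inE; apply/imsetP/idP => [[x _ ->]|de].
  exact: (valP x).
by exists (Sub d de).
Qed.

Lemma span_sum_del (R : comNzRingType) (q : R) (G : mgraph) (e : edge G) S :
  @span_sum R q (del e) setT setT S = span_sum q setT [set~ e] S.
Proof.
rewrite -(span_sum_embedding (del_embedding e)) imset_val_del.
by rewrite !imset_id.
Qed.

(** Stable sets of the contraction correspond to the stable sets of G for which
    e is not a boundary edge. *)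
Lemma spans_contract (G : mgraph) (e : edge G) A r :
  @spans (contract e) setT A [set exist _ (Defs.merge e r) (merge_subproof e r)] =
  spans setT (e |: (val @: A)) [set r].
Proof.
have je : joins e (src e) (tgt e) by apply/joins_endsP; left.
have mergeW (W : {set vertex G}) x : (src e \in W) = (tgt e \in W) ->
    (Defs.merge e x \in W) = (x \in W).
  by rewrite /Defs.merge; case: eqP => // ->.
apply/spansP/spansP => H W.
  rewrite (stableU1 _ _ je) sub1set => /andP[/stableP st /eqP eW] rW.
  have := H [set x | val x \in W]; rewrite sub1set inE /= mergeW //.
  have st' : @stable (contract e) A [set x | val x \in W].
    apply/stableP => d dA; rewrite !inE /= !mergeW //.
    by apply: st; rewrite imset_f.
  move=> /(_ st' rW) /subsetP sW; apply/subsetP => x _.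
  have := sW (exist _ (Defs.merge e x) (merge_subproof e x)).
  by rewrite !inE /= mergeW //; apply.
rewrite sub1set => /stableP st rW.
pose W' := [set x | exist _ (Defs.merge e x) (merge_subproof e x) \in W].
have st' : stable (e |: (val @: A)) W'.
  rewrite (stableU1 _ _ je); apply/andP; split.
    apply/stableP => _ /imsetP[d dA ->]; by rewrite !inE; exact: (st d dA).
  rewrite !inE; apply/eqP; apply: (congr1 (fun z => z \in W)); apply: val_inj => /=.
  by rewrite /Defs.merge eqxx; case: eqP.
have := H _ st'; rewrite sub1set inE => /(_ rW) /subsetP sW.
apply/subsetP => x _; have := sW (val x); rewrite !inE => /(_ isT).
suff -> : exist _ (Defs.merge e (val x)) (merge_subproof e (val x)) = x by [].
apply: val_inj => /=; rewrite /Defs.merge; case: eqP => // xt.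
by have := valP x; rewrite /= xt eqxx orbF => /eqP.
Qed.

Lemma span_sum_contract (R : comNzRingType) (q : R) (G : mgraph) (e : edge G) r :
  @span_sum R q (contract e) setT setT [set exist _ (Defs.merge e r) (merge_subproof e r)] =
  \sum_(A : {set edge G} | A \subset [set~ e])
    (spans setT (e |: A) [set r])%:R * q ^+ #|A|.
Proof.
rewrite -imset_val_del sum_subset_imset; last exact: val_inj.
by apply: eq_bigr => A _; rewrite spans_contract card_imset //; exact: val_inj.
Qed.

Lemma span_sum_delcontr (R : comNzRingType) (q : R) (G : mgraph) (e : edge G) r :
  span_sum q [set: vertex G] setT [set r] =
  @span_sum R q (del e) setT setT [set r : vertex (del e)] +
  q * @span_sum R q (contract e) setT setT
    [set exist _ (Defs.merge e r) (merge_subproof e r)].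
Proof.
rewrite span_sum_contract span_sum_del -span_sumU1 ?inE ?eqxx //.
by rewrite setUCr.
Qed.

Lemma adj_in_sym (G : mgraph) (F : {set edge G}) :
  connect_sym (adj_in F).
Proof.
by apply: sym_connect_sym => x y; apply: eq_existsb => d; rewrite /joins orbC.
Qed.

Lemma stable_component (G : mgraph) (F : {set edge G}) x :
  stable F [set y | connect (adj_in F) x y].
Proof.
apply/stableP => d dF; rewrite !inE; apply: same_connect_r => //.
  exact: adj_in_sym.
by apply: connect1; apply/existsP; exists d; rewrite dF /joins !eqxx.
Qed.

Lemma connect_stable (G : mgraph) (F : {set edge G}) (W : {set vertex G}) x y :
  stable F W -> connect (adj_in F) x y -> (x \in W) = (y \in W).
Proof.
move=> st /connectP[s sp ->]; elim: s x sp => [|z s IH] x //=.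
case/andP => /existsP[d /andP[dF jo]] /IH <-.
by have := stableP _ _ st d dF; have /joins_endsP[[-> ->]|[-> ->]] := jo.
Qed.

(** For a bridge the deletion term of [span_sum_delcontr] vanishes; for any other
    edge the deletion remains connected, as the induction on the number of
    edges requires. *)
Lemma bridgeE (G : mgraph) (e : edge G) r : spans setT setT [set r] ->
  bridge e = ~~ spans setT [set~ e] [set r].
Proof.
move=> conn; rewrite /bridge; congr (~~ _); apply/idP/spansP => [con W st rW|H].
  apply: (spansP _ _ _ conn) => //; apply/stableP => d _.
  have [->|de] := eqVneq d e; first exact: connect_stable con.
  by apply: (stableP _ _ st); rewrite !inE.
have /subsetP cr : setT \subset [set y | connect (adj_in [set~ e]) r y].
  by apply: H; rewrite ?stable_component // sub1set inE connect0.
apply: (@connect_trans _ _ r); first rewrite adj_in_sym.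
  by have := cr (src e); rewrite !inE; apply.
by have := cr (tgt e); rewrite !inE; apply.
Qed.

Lemma spans_del (G : mgraph) (e : edge G) S :
  @spans (del e) setT setT S = spans setT [set~ e] S.
Proof.
rewrite -(spans_embedding (del_embedding e)) imset_val_del.
by rewrite !imset_id.
Qed.

Lemma spans_loop (G : mgraph) (e : edge G) U A S : loop e ->
  spans U (e |: A) S = spans U A S.
Proof.
move=> /eqP le; have je : joins e (src e) (src e) by apply/joins_endsP; left; rewrite -le.
by apply: eq_forallb => W; rewrite (stableU1 _ _ je) eqxx andbT.
Qed.

Lemma card_del_edge (G : mgraph) (e : edge G) n :
  #|edge G| = n.+1 -> #|edge (del e)| = n.
Proof. by move=> cE; rewrite /= card_sig (cardC1 e) cE. Qed.

Lemma card_contract (G : mgraph) (e : edge G) : ~~ loop e ->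
  #|vertex G| = #|vertex (contract e)|.+1.
Proof.
move=> le; rewrite /= card_sig [LHS](cardD1 (tgt e)) inE add1n; congr _.+1; apply: eq_card => x.
rewrite !inE andbT orbC; have [->|//] := eqVneq x (tgt e).
by apply/esym/negbTE; rewrite eq_sym.
Qed.

(** Induction along the recursion, which preserves connectedness: contraction
    always does, and deletion is used only for non-bridges.  A loop may be added
    to a connecting set at will, whence the factor 1 + q = y; a bridge belongs
    to all of them.  Contracting a non-loop uses up one vertex, which accounts
    for the factor q in front of the contraction. *)
Lemma tutte1_span_sum (G : mgraph) (r : vertex G) : spans setT setT [set r] ->
  ('X - 1) ^+ #|vertex G|.-1 * tutte1 G =
  span_sum ('X - 1) [set: vertex G] setT [set r].
Proof.
rewrite /tutte1 /tutte; move: {-1}#|edge G| (erefl #|edge G|) => n.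
elim: n G r => [|n IH] G r cE conn /=.
  have E0 : setT = set0 :> {set edge G} by apply/eqP; rewrite -cards_eq0 cardsT cE.
  have V1 : [set: vertex G] = [set r].
    apply/eqP; rewrite eqEsubset subsetT andbT.
    by apply: (spansP _ _ _ conn) => //; apply/stableP => e; rewrite E0 in_set0.
  by rewrite -cardsT E0 span_sum0 V1 cards1 subxx expr0 mul1r hornerC.
case: pickP => [e _|noE]; last first.
  by move: cE; rewrite (eq_card0 noE).
have cE' := card_del_edge e cE.
have sC : spans setT setT [set exist _ (Defs.merge e r) (merge_subproof e r) : vertex (contract e)].
  rewrite spans_contract; apply/spansP => W st; apply: (spansP _ _ _ conn).
  have := st; apply: stable_sub; apply/subsetP => d _.
  have [->|de] := eqVneq d e; first by rewrite setU11.
  by rewrite inE; apply/orP; right; apply/imsetP; exists (Sub d de).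
rewrite (span_sum_delcontr _ e r).
case: ifP => [le|/negbT le].
  have sD : spans setT setT [set r : vertex (del e)].
    by rewrite spans_del -(spans_loop _ _ _ le) setUCr.
  have -> : span_sum ('X - 1) setT setT [set exist _ (Defs.merge e r) (merge_subproof e r) : vertex (contract e)]
     = span_sum ('X - 1) setT setT [set r : vertex (del e)] :> {poly int}.
    rewrite span_sum_contract span_sum_del; apply: eq_bigr => A _.
    by rewrite spans_loop.
  rewrite -(IH (del e) r cE' sD) !hornerE /=; ring.
have cV := card_contract le.
have cV0 : (0 < #|vertex (contract e)|)%N by rewrite (cardD1 (exist _ (Defs.merge e r) (merge_subproof e r))) .
rewrite (bridgeE e conn) -spans_del.
have IHC := IH (contract e) _ cE' sC.
case: ifP => [br|/negbFE sD].
  have -> : span_sum ('X - 1) setT setT [set r : vertex (del e)] = 0 :> {poly int}.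
    rewrite span_sum_del /span_sum big1 // => A AK.
    suff /negPf-> : ~~ spans setT A [set r] by rewrite mul0r.
    move: br; rewrite spans_del; apply: contra => /spansP sA; apply/spansP => W st.
    by apply: sA; apply: stable_sub st.
  rewrite -IHC hornerM hornerX cV /= -[X in _ ^+ X](prednK cV0) exprS; ring.
rewrite -IHC -(IH (del e) r cE' sD) hornerD /= cV.
by rewrite -(prednK cV0) exprS /=; ring.
Qed.

(** * Cones of rooted graphs *)

Section ConeSets.
Variable G : mgraph.
Implicit Types (U : {set vertex G}) (F : {set edge G}) (w x : vertex G).

Definition cone_vertices U : {set vertex (cone G)} :=
  [set z : option (vertex G) | if z is Some x then x \in U else true].

(** The spoke at the root w is left out, so that 1-sums at the root become
    edge-disjoint unions of cones. *)
Definition cone_edges F U w : {set edge (cone G)} :=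
  [set a : edge G + vertex G |
    match a with inl e => e \in F | inr x => (x \in U) && (x != w) end].

Lemma cone_verticesT : cone_vertices setT = setT.
Proof. by apply/setP => -[x|]; rewrite !inE. Qed.

Lemma cone_edgesT w : cone_edges setT setT w = [set~ inr w].
Proof. by apply/setP => -[e|x]; rewrite !inE. Qed.

Lemma cone_vertices_None U : None \in cone_vertices U.
Proof. by rewrite inE. Qed.

Lemma supported_cone F U w : w \in U -> supported F U ->
  supported (cone_edges F U w) (cone_vertices U).
Proof.
move=> wU /supportedP sF; apply/supportedP => -[e|x]; rewrite !inE /=.
  exact: sF.
by case/andP.
Qed.

Lemma joins_spoke x : @joins (cone G) (inr x) None (Some x).
Proof. by apply/joins_endsP; right. Qed.

Lemma joins_cone e u x : joins e u x -> @joins (cone G) (inl e) (Some u) (Some x).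
Proof. by case/joins_endsP => -[su tu]; apply/joins_endsP; [left|right]; rewrite /= su tu. Qed.

End ConeSets.

Section RootedCone.
Variables (R : comNzRingType) (q : R).

(** The pair (C, D): the second component treats the root as connected to the
    apex, as if its missing spoke were contracted. *)
Definition rooted_cone (G : mgraph) (F : {set edge G}) (U : {set vertex G})
    (w : vertex G) : R * R :=
  (span_sum q (cone_vertices U) (cone_edges F U w) [set None],
   span_sum q (cone_vertices U) (cone_edges F U w) [set None; Some w]).

Definition glue (a b : R * R) : R * R :=
  (a.1 * b.2 + a.2 * b.1 - a.1 * b.1, a.2 * b.2).

Definition extend (a : R * R) : R * R :=
  (q * (a.1 + q * a.2), a.1 + q * a.2 + q * ((1 + q) * a.2)).

(** Restores the missing spoke. *)
Definition close_cone (a : R * R) : R := a.1 + q * a.2.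

Lemma close_coneE (G : mgraph) (w : vertex G) :
  close_cone (rooted_cone setT setT w) =
  @span_sum R q (cone G) setT setT [set None].
Proof.
rewrite /close_cone /rooted_cone /= cone_verticesT cone_edgesT.
rewrite -(span_sum_edge1 _ _ (joins_spoke w)); last by rewrite !inE eqxx.
by rewrite setUCr.
Qed.

(** The new root has no spoke, so the former root first receives its own, and
    then the edge e is attached in series. *)
Lemma rooted_cone_extend (G : mgraph) (F : {set edge G})
    (U : {set vertex G}) (w x : vertex G) (e : edge G) :
  joins e w x -> e \notin F -> x \notin U -> w \in U -> supported F U ->
  rooted_cone (e |: F) (x |: U) x = extend (rooted_cone F U w).
Proof.
move=> jo eF xU wU sF.
have xw : x != w by apply: contraNneq xU => ->.
  have EV : cone_vertices (x |: U) = Some x |: cone_vertices U.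
    by apply/setP => -[y|]; rewrite !inE.
  have EE : cone_edges (e |: F) (x |: U) x = inl e |: (inr w |: cone_edges F U w).
    apply/setP => -[d|y]; rewrite !inE //.
    have [->|yx] := eqVneq y x; first by rewrite andbF /= [inr _ == _](negPf xw) (negPf xU).
    rewrite andbT /=; have [->|yw] := eqVneq y w; first by rewrite wU eqxx.
    by rewrite [inr _ == _](negPf yw) andbT.
rewrite /rooted_cone EV EE.
have sw : @supported (cone G) (inr w |: cone_edges F U w) (cone_vertices U).
  apply/supportedP => d; rewrite in_setU1 => /predU1P[->|]; first by rewrite !inE.
  exact/supportedP/supported_cone.
have ne : inl e \notin inr w |: cone_edges F U w by rewrite !inE.
have nw : inr w \notin cone_edges F U w by rewrite !inE eqxx andbF.
have nx : Some x \notin cone_vertices U by rewrite inE.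
have iw : Some w \in cone_vertices U by rewrite inE.
have jc := joins_cone jo; have i0 := cone_vertices_None U.
rewrite (span_sum_pendant1 _ jc) // (span_sum_pendant2 _ jc) //.
by rewrite (span_sum_edge1 _ _ (joins_spoke w)) // (span_sum_edge2 _ _ (joins_spoke w)).
Qed.

Lemma rooted_cone_glue (G : mgraph) (F1 F2 : {set edge G})
    (U1 U2 : {set vertex G}) (w : vertex G) :
  supported F1 U1 -> supported F2 U2 -> [disjoint F1 & F2] ->
  U1 :&: U2 = [set w] ->
  rooted_cone (F1 :|: F2) (U1 :|: U2) w =
  glue (rooted_cone F1 U1 w) (rooted_cone F2 U2 w).
Proof.
move=> s1 s2 dis U12.
have /setIP[w1 w2] : w \in U1 :&: U2 by rewrite U12 inE.
have EV : cone_vertices (U1 :|: U2) = cone_vertices U1 :|: cone_vertices U2.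
  by apply/setP => -[y|]; rewrite !inE.
have EE : cone_edges (F1 :|: F2) (U1 :|: U2) w =
          cone_edges F1 U1 w :|: cone_edges F2 U2 w.
  by apply/setP => -[d|y]; rewrite !inE // andb_orl.
have c1 := supported_cone w1 s1; have c2 := supported_cone w2 s2.
have cdis : [disjoint cone_edges F1 U1 w & cone_edges F2 U2 w].
  apply/pred0P => -[d|y] /=; rewrite !inE; first exact: (pred0P dis d).
  rewrite andbACA andbb -in_setI U12 inE; by case: eqP.
have cU : cone_vertices U1 :&: cone_vertices U2 = [set None; Some w].
  by apply/setP => -[y|]; rewrite !inE // -in_setI U12 inE.
by rewrite /rooted_cone EV EE (span_sum_parallel1 _ cU) // span_sum_parallel2.
Qed.

Lemma rooted_cone_embedding (G G' : mgraph) (p : vertex G -> vertex G')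
    (d : edge G -> edge G') (F : {set edge G}) (U : {set vertex G}) w : embedding p d ->
  rooted_cone (d @: F) (p @: U) (p w) = rooted_cone F U w.
Proof.
case=> pI dI jo.
pose p' : vertex (cone G) -> vertex (cone G') := omap p.
pose d' : edge (cone G) -> edge (cone G') :=
  fun a => match a with inl e => inl (d e) | inr x => inr (p x) end.
have p'I : injective p' by move=> [x|] [y|] //= [/pI->].
have d'I : injective d' by move=> [x|x] [y|y] //= [] => [/dI|/pI] ->.
have emb : embedding p' d'.
  split=> // -[e|x]; last by apply/joins_endsP; left.
  exact: joins_cone.
have EV : cone_vertices (p @: U) = p' @: cone_vertices U.
  apply/setP => -[y|]; last first.
    by rewrite inE; apply/esym/imsetP; exists None; rewrite ?inE.
  rewrite inE; apply/imsetP/imsetP => [[x xU ->]|[[x|] //]].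
    by exists (Some x); rewrite ?inE.
  by rewrite inE => xU [->]; exists x.
have EE : cone_edges (d @: F) (p @: U) (p w) = d' @: cone_edges F U w.
  apply/setP => -[e|y]; rewrite inE.
    apply/imsetP/imsetP => [[x xF ->]|[[x|x] //]]; first by exists (inl x); rewrite ?inE.
    by rewrite inE => xF [->]; exists x.
  apply/andP/imsetP => [[/imsetP[x xU ->] xw]|[[x|x] //]].
    by exists (inr x); rewrite // inE xU; apply: contra xw => /eqP->.
  rewrite inE => /andP[xU xw] [->]; split; first exact: imset_f.
  by apply: contra xw => /eqP/pI->.
by rewrite /rooted_cone EV EE -!(span_sum_embedding emb) imsetU1 !imset_set1.
Qed.

Lemma rooted_cone1 (G : mgraph) (w : vertex G) :
  rooted_cone set0 [set w] w = (0, 1).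
Proof.
rewrite /rooted_cone; have -> : cone_edges set0 [set w] w = set0.
  by apply/setP => -[e|x]; rewrite !inE //; case: eqP.
rewrite !span_sum0; congr (_ , _).
  case: subsetP => // /(_ (Some w)); by rewrite !inE eqxx => /(_ isT).
by case: subsetP => // -[] [x|]; rewrite !inE.
Qed.

End RootedCone.

(** The exponent is |V(Cone(G))| - 1 = |V(G)|. *)
Lemma f_rooted_cone (G : mgraph) (w : vertex G) :
  ('X - 1) ^+ #|vertex G| * f G =
  close_cone ('X - 1) (rooted_cone ('X - 1) setT setT w).
Proof.
rewrite close_coneE -(@tutte1_span_sum (cone G) None) ?card_option //.
apply/spansP => W st; rewrite sub1set => NW; apply/subsetP => -[x|] _ //.
by have := stableP _ _ st (inr x) (in_setT _); rewrite /= NW => ->.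
Qed.

(** The cone without the spoke at w is connected unless w has no neighbour; in
    that case no edge set connects w to the apex, in accordance with the
    convention that [g] vanishes. *)
Lemma g_rooted_cone (G : mgraph) (w : vertex G) :
  ('X - 1) ^+ #|vertex G| * g w = (rooted_cone ('X - 1) setT setT w).1.
Proof.
rewrite /rooted_cone /= cone_verticesT cone_edgesT /g.
case: ifPn => [/existsP[u /andP[uw wu]]|iso].
  rewrite -(@span_sum_del _ _ (cone G) (inr w)).
  rewrite -(@tutte1_span_sum (@del (cone G) (inr w)) None) ?card_option //.
  rewrite spans_del; apply/spansP => W st; rewrite sub1set => NW.
  have xW x : x != w -> Some x \in W.
    by move=> xw; have := stableP _ _ st (inr x); rewrite /= NW; apply; rewrite !inE.
  apply/subsetP => -[x|] _ //; have [->|/xW //] := eqVneq x w.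
  case/existsP: wu => d /andP[_ jo]; have := stableP _ _ st (inl d).
  rewrite !inE => /(_ isT) /=; have := xW u uw.
  by have /joins_endsP[[-> ->]|[-> ->]] := jo => ->.
rewrite mulr0 /span_sum big1 // => A Aw.
suff /negPf-> : ~~ spans setT A [set None : vertex (cone G)] by rewrite mul0r.
apply/spansP => /(_ [set~ Some w]).
have st : stable A [set~ Some w : vertex (cone G)].
  apply/stableP => -[e|x] dA; rewrite !inE; last first.
    by have := subsetP Aw _ dA; rewrite !inE.
  rewrite /=; apply: contraNeq iso => ne.
  have [sw|sw] := eqVneq (src e) w.
    apply/existsP; exists (tgt e); apply/andP; split.
      by apply: contra ne => /eqP tw; rewrite sw tw.
    by apply/existsP; exists e; rewrite inE /joins sw !eqxx.
  apply/existsP; exists (src e); rewrite sw; apply/existsP; exists e.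
  have [tw|tw] := eqVneq (tgt e) w; first by rewrite inE /joins tw !eqxx orbT.
  case/negP: ne; apply/eqP/negb_inj; rewrite !negbK.
  by rewrite [LHS](negPf sw) [RHS](negPf tw).
by rewrite st sub1set !inE => /(_ isT isT) /subsetP /(_ (Some w)); rewrite !inE eqxx => /(_ isT).
Qed.

(** * The algebra of the tree shift *)

(** Cayley-Hamilton for [extend]: its matrix has trace 3 q + q^2 and determinant
    q^2 + q^3, and all its powers are combinations of the identity and itself. *)
Lemma iter_extend (R : comNzRingType) (q : R) n :
  exists u z : R, forall a, iter n (extend q) a =
    (u * a.1 + z * (q * a.1 + q ^+ 2 * a.2),
     u * a.2 + z * (a.1 + (2%:R * q + q ^+ 2) * a.2)).
Proof.
elim: n => [|n [u [z IH]]].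
  by exists 1, 0 => -[c d] /=; congr (_, _); ring.
exists (- z * (q ^+ 2 + q ^+ 3)), (u + z * (3%:R * q + q ^+ 2)) => a.
by rewrite iterS IH /extend /=; congr (_, _); ring.
Qed.

(** The algebraic core of the theorem: a and b stand for H1 and H2, the pair
    (0, 1) for a single vertex from which the path is grown. *)
Lemma close_cone_tree_shift (R : comNzRingType) (q : R) n (a b : R * R) :
  q ^+ 2 * (close_cone q (glue (iter n (extend q) a) b) -
            close_cone q (glue (glue a b) (iter n (extend q) (0, 1)))) =
  (1 + q) * a.1 * b.1 * (iter n (extend q) (0, 1)).1.
Proof.
have [u [z E]] := iter_extend q n.
by rewrite !E /close_cone /glue /=; ring.
Qed.

(** * Growing a path at the root *)

Section Chain.
Variables (R : comNzRingType) (q : R) (G : mgraph).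
Variables (F : {set edge G}) (U : {set vertex G}).
Variables (x : nat -> vertex G) (e : nat -> edge G).

Definition chain_vertices n := U :|: \bigcup_(j < n) [set x j.+1].
Definition chain_edges n := F :|: \bigcup_(j < n) [set e j].

Lemma chain_verticesS n : chain_vertices n.+1 = x n.+1 |: chain_vertices n.
Proof. by rewrite /chain_vertices big_ord_recr /= setUA setUC. Qed.

Lemma chain_edgesS n : chain_edges n.+1 = e n |: chain_edges n.
Proof. by rewrite /chain_edges big_ord_recr /= setUA setUC. Qed.

Lemma chain_verticesP n y :
  reflect (y \in U \/ exists2 j, (j < n)%N & y = x j.+1) (y \in chain_vertices n).
Proof.
rewrite inE; apply: (iffP orP) => -[yU|yx]; try (by left).
  by case/bigcupP: yx => j _ /set1P ->; right; exists (val j); rewrite ?ltn_ord.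
by case: yx => j jn ->; right; apply/bigcupP; exists (Ordinal jn); rewrite ?inE.
Qed.

Lemma chain_edgesP n d :
  reflect (d \in F \/ exists2 j, (j < n)%N & d = e j) (d \in chain_edges n).
Proof.
rewrite inE; apply: (iffP orP) => -[yU|yx]; try (by left).
  by case/bigcupP: yx => j _ /set1P ->; right; exists (val j); rewrite ?ltn_ord.
by case: yx => j jn ->; right; apply/bigcupP; exists (Ordinal jn); rewrite ?inE.
Qed.

Variable m : nat.
Hypotheses (sF : supported F U) (x0 : x 0 \in U).
Hypothesis xU : forall i, (i < m)%N -> x i.+1 \notin U.
Hypothesis xI : forall i j, (i <= m)%N -> (j <= m)%N -> x i = x j -> i = j.
Hypothesis ex : forall i, (i < m)%N -> joins (e i) (x i) (x i.+1).

Lemma chain_vertices_last n : x n \in chain_vertices n.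
Proof.
case: n => [|n]; apply/chain_verticesP; [by left | by right; exists n].
Qed.

Lemma chain_vertices_new n : (n < m)%N -> x n.+1 \notin chain_vertices n.
Proof.
move=> nm; apply/chain_verticesP => -[|[j jn xnj]]; first exact/negP/xU.
have [nj] := xI nm (leq_trans jn (ltnW nm)) xnj.
by rewrite nj ltnn in jn.
Qed.

Lemma chain_supported n : (n <= m)%N ->
  supported (chain_edges n) (chain_vertices n).
Proof.
elim: n => [_|n IH nm].
  by rewrite /chain_edges /chain_vertices !big_ord0 !setU0.
rewrite chain_verticesS chain_edgesS; apply/supportedP => d.
rewrite in_setU1 => /predU1P[->|dF].
  rewrite !inE; have := chain_vertices_last n; rewrite inE => xn.
  by have /joins_endsP[[-> ->]|[-> ->]] := ex nm; rewrite xn eqxx ?orbT.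
have [sd td] := supportedP _ _ (IH (ltnW nm)) d dF.
by rewrite !in_setU1 sd td !orbT.
Qed.

Lemma chain_edges_new n : (n < m)%N -> e n \notin chain_edges n.
Proof.
move=> nm; apply: contra (chain_vertices_new nm) => en.
have := supportedP _ _ (chain_supported (ltnW nm)) _ en.
by have /joins_endsP[[-> ->]|[-> ->]] := ex nm => -[].
Qed.

Lemma rooted_cone_chain n : (n <= m)%N ->
  rooted_cone q (chain_edges n) (chain_vertices n) (x n) =
  iter n (extend q) (rooted_cone q F U (x 0)).
Proof.
elim: n => [_|n IH nm].
  by rewrite /chain_edges /chain_vertices !big_ord0 !setU0.
rewrite chain_edgesS chain_verticesS (rooted_cone_extend q (ex nm)) ?iterS.
- by rewrite (IH (ltnW nm)).
- exact: chain_edges_new.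
- exact: chain_vertices_new.
- exact: chain_vertices_last.
- exact: chain_supported (ltnW nm).
Qed.

Lemma card_chain_vertices n : (n <= m)%N ->
  #|chain_vertices n| = (#|U| + n)%N.
Proof.
elim: n => [_|n IH nm].
  by rewrite /chain_vertices !big_ord0 !setU0 addn0.
by rewrite chain_verticesS cardsU1 chain_vertices_new // (IH (ltnW nm)) add1n addnS.
Qed.

End Chain.

(** * Path graphs and 1-sums *)

Section PathAndSum.
Variables (R : comNzRingType) (q : R).

Lemma rooted_cone_path n : (0 < n)%N ->
  @rooted_cone R q (path_graph n) setT setT ord_max =
  iter n (extend q) (0, 1).
Proof.
case: n => // n _.
pose G := path_graph n.+1.
pose x : nat -> vertex G := fun i => inord i : 'I_n.+2.
pose e : nat -> edge G := fun i => inord i : 'I_n.+1.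
have xI i j : (i <= n.+1)%N -> (j <= n.+1)%N -> x i = x j -> i = j.
  by move=> i1 j1 /(congr1 val); rewrite /= !inordK.
have ex i : (i < n.+1)%N -> joins (e i) (x i) (x i.+1).
  move=> i1; apply/joins_endsP; left.
  by split; apply: val_inj; rewrite /= !inordK // ltnW.
have := @rooted_cone_chain R q G set0 [set x 0] x e n.+1 _ _ _ xI ex n.+1 (leqnn _).
rewrite rooted_cone1 => <-.
- congr rooted_cone.
  + apply/esym/setP => d; rewrite [RHS]inE; apply/chain_edgesP; right.
    exists (val d); first exact: ltn_ord.
    by rewrite /e inord_val.
  + apply/esym/setP => y; rewrite [RHS]inE; apply/chain_verticesP.
    have [y0|y0] := posnP (val y); [left | right].
      by rewrite inE; apply/eqP/val_inj; rewrite /= inordK ?y0.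
    exists (val y).-1; first by rewrite -ltnS prednK //; exact: ltn_ord.
    by apply: val_inj; rewrite /= prednK // inordK.
  + by apply: val_inj; rewrite /= inordK.
- by apply/supportedP => d; rewrite in_set0.
- by rewrite inE.
- by move=> i i1; rewrite inE; apply/negP => /eqP /xI H; have := H i1 isT.
Qed.

(** The theorem takes g at the first vertex of the path, but the path is grown
    towards, and attached at, its last vertex. *)
Lemma rooted_cone_path_rev n :
  @rooted_cone R q (path_graph n) setT setT ord0 =
  @rooted_cone R q (path_graph n) setT setT ord_max.
Proof.
have emb : @embedding (path_graph n) (path_graph n) (@rev_ord _) (@rev_ord _).
  split; [exact: rev_ord_inj | exact: rev_ord_inj |] => d.
  apply/joins_endsP; right; split; apply: val_inj => /=;
    have := ltn_ord d; rewrite /bump /=; lia.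
rewrite -(@rooted_cone_embedding _ q (path_graph n) _ _ _ setT setT ord0 emb).
have rT j : [set rev_ord y | y in [set: 'I_j]] = setT.
  by apply/setP => y; rewrite [RHS]inE; apply/imsetP; exists (rev_ord y); rewrite ?rev_ordK.
rewrite !rT; congr rooted_cone; by apply: val_inj => /=; rewrite subn1.
Qed.

Lemma rooted_cone_onesum (G1 G2 : mgraph) (w1 : vertex G1) (w2 : vertex G2) :
  rooted_cone q setT setT (onesum_pt w1 w2) =
  glue (rooted_cone q setT setT w1) (rooted_cone q setT setT w2).
Proof.
pose G := onesum w1 w2.
pose p1 : vertex G1 -> vertex G := inl; pose d1 : edge G1 -> edge G := inl.
pose p2 : vertex G2 -> vertex G := onesum_inr w1 w2; pose d2 : edge G2 -> edge G := inr.
have p2w : p2 w2 = inl w1 by rewrite /p2 /onesum_inr insubN ?eqxx.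
have p2n y (yw : y != w2) : p2 y = inr (Sub y yw) by rewrite /p2 /onesum_inr insubT.
have emb1 : embedding p1 d1.
  by split=> [y z []|y z []|d] //; apply/joins_endsP; left.
have emb2 : embedding p2 d2.
  split=> [y z|y z []|d] //; last by apply/joins_endsP; left.
  have [->|yw] := eqVneq y w2; have [->|zw] := eqVneq z w2 => //;
    rewrite ?p2w ?p2n //; by case.
rewrite -(rooted_cone_embedding q _ _ w1 emb1) -(rooted_cone_embedding q _ _ w2 emb2).
rewrite p2w -rooted_cone_glue.
- congr rooted_cone; apply/esym/setP => y; rewrite [RHS]inE inE.
    by case: y => d; rewrite (imset_f d1, imset_f d2) ?orbT.
  case: y => [y|[y yw]]; first by rewrite (imset_f p1).
  by apply/orP; right; apply/imsetP; exists y; rewrite ?p2n.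
- by apply/supportedP => _ /imsetP[d _ ->]; rewrite /= !(imset_f p1).
- by apply/supportedP => _ /imsetP[d _ ->]; rewrite /= !(imset_f p2).
- apply/pred0P => y /=; apply/negP => /andP[/imsetP[d _ ->] /imsetP[d' _ //]].
- apply/setP => y; rewrite !inE; apply/andP/eqP => [[/imsetP[z _ ->]]|->].
    case/imsetP => t _; have [->|tw] := eqVneq t w2; first by rewrite p2w.
    by rewrite p2n.
  by split; apply/imsetP; [exists w1 | exists w2].
Qed.

End PathAndSum.

(** * Decomposition of a tree along a path *)

(** A repetition-free walk joining the ends of e without using e would close up
    with e to a cycle. *)
Lemma acyclic_bridge (G : mgraph) (e : edge G) : acyclic G -> bridge e.
Proof.
move=> acyc; apply/negP => /connectP[s0 sp0 lst0].
case/shortenP: sp0 lst0 => s sp us _ lst.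
set c := fun i => nth (src e) (src e :: s) i.
have cI i j : (i <= size s)%N -> (j <= size s)%N -> c i = c j -> i = j.
  by move=> si sj /eqP; rewrite nth_uniq // => /eqP.
have step i : (i < size s)%N ->
    exists2 d, d != e & joins d (c i) (c i.+1).
  by move/(pathP (src e)): sp => sp /sp /existsP[d /andP[de jo]]; exists d; rewrite // -in_setC1.
pose d i := if (i < size s)%N then
  odflt e [pick d | (d != e) && joins d (c i) (c i.+1)] else e.
have dP i : (i < size s)%N -> d i != e /\ joins (d i) (c i) (c i.+1).
  move=> si; rewrite /d si; case: pickP => [a /andP[] //|no].
  by have [a ae jo] := step i si; have := no a; rewrite ae jo.
apply: (acyc (size s) (fun i => c i) (fun i => d i)) => [i j /cI H|i j|i].
- by apply: val_inj; apply: H; rewrite -ltnS.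
- move=> dij; apply: val_inj => /=; case: i j dij => [i i1] [j j1] /= dij.
  case: (ltnP i (size s)) (ltnP j (size s)) => [si|si] [sj|sj]; last by lia.
  + have [_ ji] := dP i si; have [_ jj] := dP j sj.
    case/joins_endsP: ji; rewrite dij => -[E1 E2]; case/joins_endsP: jj;
      rewrite E1 E2 => -[H H'].
    * exact: cI H.
    * have := cI _ _ _ _ H; have := cI _ _ _ _ H'; lia.
    * have := cI _ _ _ _ H; have := cI _ _ _ _ H'; lia.
    * exact: cI H'.
  (* The closing edge e is not among the edges of the walk. *)
  + by have [/eqP[]] := dP i si; rewrite dij /d ltnNge sj.
  + by have [/eqP[]] := dP j sj; rewrite -dij /d ltnNge si.
- have := ltn_ord i; rewrite ltnS leq_eqVlt => /orP[/eqP iE|il].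
    rewrite /d iE ltnn; apply/joins_endsP; right.
    rewrite /= iE modnn; split=> //.
    by rewrite /c lst -[LHS]nth_last /=; case: (s).
  by rewrite /= modn_small ?ltnS //; case: (dP i il).
Qed.

Section TreePath.
Variables (R : comNzRingType) (q : R) (T : mgraph) (k : nat) (v : nat -> vertex T).
Hypotheses (hT : is_tree T) (hk : (2 <= k)%N) (hv : is_path k v).
Hypothesis hdeg : forall i : nat, (1 < i < k)%N -> degree (v i) = 2%N.

Let x i := v i.+1.
Let m := k.-1.
Let mk : k = m.+1. Proof. by rewrite /m prednK // ltnW. Qed.

Lemma path_vertex_inj i j : (i <= m)%N -> (j <= m)%N -> x i = x j -> i = j.
Proof.
move=> im jm xij; apply: succn_inj; have [inj _] := hv.
by apply: inj xij; rewrite mk /= ltnS.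
Qed.

Lemma path_edge_exists : exists e : nat -> edge T,
  forall i, (i < m)%N -> joins (e i) (x i) (x i.+1).
Proof.
have [_ ad] := hv.
have step i : (i < m)%N -> exists d, joins d (x i) (x i.+1).
  move=> im; have /existsP[d /andP[_ jo]] : adj (v i.+1) (v i.+2) by apply: ad; lia.
  by exists d.
have m0 : (0 < m)%N by rewrite /m; lia.
have [e0 _] := step _ m0.
exists (fun i => odflt e0 [pick d | joins d (x i) (x i.+1)]) => i /step[d jo].
by case: pickP => [a //|/(_ d)]; rewrite jo.
Qed.

Variable e : nat -> edge T.
Hypothesis ex : forall i, (i < m)%N -> joins (e i) (x i) (x i.+1).

(** Two parallel edges would not be bridges. *)
Lemma path_edge_unique i d : (i < m)%N -> joins d (x i) (x i.+1) -> d = e i.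
Proof.
move=> im jo; apply/eqP/negPn/negP => de; have [_ acyc] := hT.
have /negP[] := acyclic_bridge (e i) acyc.
have con u w : joins d u w -> connect (adj_in [set~ e i]) u w.
  by move=> juw; apply: connect1; apply/existsP; exists d; rewrite !inE de.
have jo' : joins d (x i.+1) (x i) by rewrite /joins orbC.
by have /joins_endsP[[-> ->]|[-> ->]] := ex im; apply: con.
Qed.

Lemma path_edges_joinsP d :
  reflect (exists2 i, (i < m)%N & d = e i) (d \in path_edges k v).
Proof.
rewrite inE; apply: (iffP existsP) => [[i /andP[i0 jo]]|[i im ->]].
  exists i.-1; first by have := ltn_ord i; lia.
  apply: path_edge_unique; first by have := ltn_ord i; lia.
  by rewrite /x prednK.
have ik : (i.+1 < k)%N by rewrite mk.
by exists (Ordinal ik) => /=; apply: ex.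
Qed.

Lemma path_interiorP y :
  reflect (exists2 i, (0 < i < m)%N & y = x i) (y \in path_interior k v).
Proof.
rewrite inE; apply: (iffP existsP) => [[i /andP[i0 /eqP ->]]|[i im ->]].
  by exists i.-1; [have := ltn_ord i; lia | rewrite /x prednK //; lia].
have ik : (i.+1 < k)%N by lia.
by exists (Ordinal ik); rewrite /= eqxx andbT; lia.
Qed.

(** The two path edges at an interior vertex already exhaust its degree. *)
Lemma interior_edge d i : (0 < i < m)%N -> src d = x i \/ tgt d = x i ->
  d = e i.-1 \/ d = e i.
Proof.
move=> /andP[i0 im] inc.
have im1 : (i.-1 < m)%N by lia.
have jo1 := ex im1; have jo2 := ex im; rewrite prednK // in jo1.
pose inc_edges := [set a : edge T | src a == x i] :|: [set a | tgt a == x i].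
have inc1 : e i.-1 \in inc_edges.
  by rewrite !inE; have /joins_endsP[[-> ->]|[-> ->]] := jo1; rewrite eqxx ?orbT.
have inc2 : e i \in inc_edges.
  by rewrite !inE; have /joins_endsP[[-> ->]|[-> ->]] := jo2; rewrite eqxx ?orbT.
have incd : d \in inc_edges by rewrite !inE; case: inc => ->; rewrite eqxx ?orbT.
have ne : e i.-1 != e i.
  apply/eqP => ee; move: jo1; rewrite ee => jo1.
  have : x i.-1 = x i.+1 \/ x i.-1 = x i.
    by have /joins_endsP[[<- _]|[_ <-]] := jo1; have /joins_endsP[[E1 E2]|[E1 E2]] := jo2;
      rewrite (E1, E2); auto.
  by case=> /path_vertex_inj H; have := H _ _; lia.
have [->|d1] := eqVneq d (e i.-1); first by left.
have [->|d2] := eqVneq d (e i); first by right.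
have hd : degree (x i) = 2%N by apply: hdeg; lia.
suff : (2 < degree (x i))%N by rewrite hd.
rewrite /degree -cardsUI; apply: leq_trans (leq_addr _ _).
have : [set d; e i.-1; e i] \subset inc_edges.
  by rewrite !subUset !sub1set incd inc1 inc2.
move/subset_leq_card; apply: leq_trans.
by rewrite -setUA cardsU1 cards2 !inE ne negb_or d1 d2.
Qed.

Let RE := remaining_edges k v.

(** By [interior_edge], removing the interior vertices removes no edge besides
    those of the path. *)
Lemma remaining_edgesE : RE = ~: path_edges k v.
Proof.
have int d y : y \in path_interior k v -> src d = y \/ tgt d = y ->
    d \in path_edges k v.
  case/path_interiorP => i im -> /(interior_edge im).
  by case=> ->; apply/path_edges_joinsP; [exists i.-1 | exists i] => //; lia.
apply/setP => d; rewrite in_setC [LHS]in_set.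
have [//|dn] := boolP (d \in path_edges k v); rewrite /=.
by apply/andP; split; apply: contra dn => /int; apply; auto.
Qed.

Let U1 := [set y | connect (adj_in RE) (v 1) y].
Let U2 := [set y | connect (adj_in RE) (v k) y].
Let F1 := [set d in RE | connect (adj_in RE) (v 1) (src d)].
Let F2 := [set d in RE | connect (adj_in RE) (v k) (src d)].

Lemma component_interior u y : u \notin path_interior k v ->
  connect (adj_in RE) u y -> y \notin path_interior k v.
Proof.
move=> un con; have st : stable RE (~: path_interior k v).
  apply/stableP => d; rewrite in_set => /and3P[_ sd td].
  by rewrite !in_setC sd td.
by have := connect_stable st con; rewrite !in_setC un.
Qed.

Lemma end_not_interior i : (i = 0 \/ i = m)%N -> x i \notin path_interior k v.
Proof.
move=> iE; apply/path_interiorP => -[j jm /path_vertex_inj H].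
by have := H _ _; lia.
Qed.

(** Otherwise a walk from v_1 to v_k off the path, followed by the path back
    from v_k to v_2, would avoid the first path edge and join its ends. *)
Lemma ends_separated y : y \in U1 -> y \notin U2.
Proof.
rewrite !inE => y1; apply/negP => y2; have [_ acyc] := hT.
have m0 : (0 < m)%N by rewrite /m; lia.
have /negP[] := acyclic_bridge (e 0) acyc.
pose W := [set z | connect (adj_in [set~ e 0]) (x 1) z].
have stW : stable [set~ e 0] W by apply: stable_component.
have xW j : (j < m)%N -> x j.+1 \in W.
  elim: j => [|j IH] jm; first by rewrite inE connect0.
  have jne : e j.+1 != e 0.
    apply/eqP => ee; have := ex jm; have := ex m0; rewrite ee.
    move=> j0 /joins_endsP[[E1 E2]|[E1 E2]]; case/joins_endsP: j0; rewrite E1 E2 => -[H H'];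
      have := path_vertex_inj _ _ H; have := path_vertex_inj _ _ H'; lia.
  have := stableP _ _ stW (e j.+1); rewrite inE in_set1 => /(_ jne).
  have /joins_endsP[[-> ->]|[-> ->]] := ex jm; have := IH (ltnW jm); by move=> ->.
have stRE : stable RE W.
  apply: stable_sub stW; apply/subsetP => d; rewrite remaining_edgesE !in_setC in_set1.
  by apply: contra => /eqP ->; apply/path_edges_joinsP; exists 0.
have xm : x m \in W by have := xW m.-1; rewrite prednK //; apply; lia.
have : x 0 \in W.
  by rewrite (connect_stable stRE y1) -(connect_stable stRE y2) {1}mk.
rewrite inE; have /joins_endsP[[-> ->]|[-> ->]] // := ex m0.
by rewrite adj_in_sym.
Qed.

Lemma component_supported u :
  supported [set d in RE | connect (adj_in RE) u (src d)]
    [set y | connect (adj_in RE) u y].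
Proof.
apply/supportedP => d; rewrite in_set => /andP[dR con].
rewrite !in_set; split=> //; have := stableP _ _ (stable_component RE u) d dR.
by rewrite !inE con => <-.
Qed.

Lemma H1_path_new i : (i < m)%N -> x i.+1 \notin U1.
Proof.
move=> im; have [->|ni] := eqVneq i.+1 m.
  apply/negP => /ends_separated; rewrite inE {1}mk -/(x m).
  by rewrite connect0.
rewrite inE; apply/negP => /component_interior; rewrite -/(x 0).
move=> /(_ (end_not_interior (or_introl erefl))) /path_interiorP [].
by exists i.+1 => //; lia.
Qed.

Let Um := chain_vertices U1 x m.
Let Fm := chain_edges F1 e m.

(** The union of the pieces is stable under all edges of the connected graph. *)
Lemma path_cover_vertices : Um :|: U2 = setT.
Proof.
have [[_ con] _] := hT.
have x0U : x 0 \in U1 by rewrite inE connect0.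
have xmU : x m \in U2 by rewrite inE /x -mk connect0.
have memW y : y \notin path_interior k v -> (y \in Um :|: U2) = (y \in U1 :|: U2).
  move=> yn; rewrite in_setU [RHS]in_setU; case yU2: (y \in U2); rewrite ?orbT // !orbF.
  apply/chain_verticesP/idP => [[//|[j jm yj]]|]; last by left.
  have [jm1|jm1] := eqVneq j.+1 m; first by rewrite yj jm1 xmU in yU2.
  by case/path_interiorP: yn; exists j.+1 => //; lia.
have xW j : (j <= m)%N -> x j \in Um :|: U2.
  move=> jm; rewrite in_setU; apply/orP; left; apply/chain_verticesP.
  by case: j jm => [|j] jm; [left | right; exists j].
have stW : stable setT (Um :|: U2).
  apply/stableP => d _; have [|dn] := boolP (d \in path_edges k v).
    case/path_edges_joinsP => i im ->; have /joins_endsP[[-> ->]|[-> ->]] := ex im;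
      by rewrite !xW // ltnW.
  have dR : d \in RE by rewrite remaining_edgesE in_setC.
  have := dR; rewrite in_set => /and3P[_ sd td]; rewrite !memW // 2!in_setU.
  by congr (_ || _); apply: (stableP _ _ (stable_component RE _)).
apply/setP => y; rewrite [RHS]inE -(connect_stable stW (con (x 0) y)).
exact: xW.
Qed.

Lemma path_meet_vertices : Um :&: U2 = [set v k].
Proof.
apply/setP => y; rewrite in_setI in_set1; apply/andP/eqP => [[]|->].
  case/chain_verticesP => [/ends_separated/negPf->//|[j jm ->]] yU2.
  have [jm1|jm1] := eqVneq j.+1 m; first by rewrite jm1 mk.
  have := yU2; rewrite inE => /component_interior.
  rewrite {1}mk => /(_ (end_not_interior (or_intror erefl))) /path_interiorP[].
  by exists j.+1 => //; lia.
split; last by rewrite inE connect0.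
by rewrite mk; apply: chain_vertices_last; rewrite inE connect0.
Qed.

Lemma path_cover_edges : Fm :|: F2 = setT.
Proof.
apply/setP => d; rewrite in_setU in_setT; apply/orP.
have [/path_edges_joinsP[i im ->]|dn] := boolP (d \in path_edges k v).
  by left; apply/chain_edgesP; right; exists i.
have dR : d \in RE by rewrite remaining_edgesE in_setC.
have := in_setT (src d); rewrite -path_cover_vertices in_setU => /orP[|sU2].
  case/chain_verticesP => [sU1|[j jm sj]].
    by left; apply/chain_edgesP; left; rewrite in_set dR; rewrite inE in sU1.
  have [jm1|jm1] := eqVneq j.+1 m.
    by right; rewrite in_set dR sj jm1 /x -mk connect0.
  have := dR; rewrite in_set => /and3P[_ /path_interiorP[]].
  by exists j.+1 => //; lia.
by right; rewrite in_set dR; rewrite inE in sU2.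
Qed.

Lemma path_disjoint_edges : [disjoint Fm & F2].
Proof.
apply/pred0P => d /=; apply/negP => /andP[/chain_edgesP dF].
rewrite in_set => /andP[dR d2]; case: dF => [|[i im dE]].
  rewrite in_set dR /= => d1; have := @ends_separated (src d); rewrite !in_set d1 d2.
  by move=> /(_ isT).
have := dR; rewrite remaining_edgesE in_setC => /path_edges_joinsP[].
by exists i.
Qed.

Lemma component_embedding (F : {set edge T}) u :
  @embedding (component F u) T val val.
Proof. by split=> [||d]; [exact: val_inj|exact: val_inj|apply/joins_endsP; left]. Qed.

Lemma rooted_cone_component u :
  rooted_cone q setT setT (component_root RE u) =
  rooted_cone q [set d in RE | connect (adj_in RE) u (src d)]
    [set y | connect (adj_in RE) u y] u.
Proof.
rewrite -(rooted_cone_embedding q _ _ _ (component_embedding RE u)).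
congr rooted_cone; apply/setP => y; rewrite [RHS]inE.
  apply/imsetP/idP => [[z _ ->]|H]; first exact: (valP z).
  by exists (Sub y H).
apply/imsetP/idP => [[z _ ->]|H]; first exact: (valP z).
by exists (Sub y H).
Qed.

(** T is grown from H1 along the path, and H2 is glued at its last vertex. *)
Lemma rooted_cone_tree :
  rooted_cone q setT setT (v k) =
  glue (iter k.-1 (extend q) (rooted_cone q setT setT (H1_root k v)))
    (rooted_cone q setT setT (H2_root k v)).
Proof.
rewrite /H1_root /H2_root !rooted_cone_component -/RE -/F1 -/F2 -/U1 -/U2.
have x0U : x 0 \in U1 by rewrite inE connect0.
have s1 := component_supported (v 1); rewrite -/F1 -/U1 in s1.
have := rooted_cone_chain q s1 x0U H1_path_new path_vertex_inj ex (leqnn m).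
rewrite -/Um -/Fm /x -mk => <-.
rewrite -rooted_cone_glue ?path_cover_edges ?path_cover_vertices //.
- exact: chain_supported s1 x0U ex _ (leqnn m).
- exact: component_supported.
- exact: path_disjoint_edges.
- exact: path_meet_vertices.
Qed.

(** The vertices v_1 and v_k are shared with H1 and H2. *)
Lemma card_tree :
  (#|vertex T| + 2 = #|vertex (H1 k v)| + #|vertex (H2 k v)| + k)%N.
Proof.
have cU u : #|vertex (component RE u)| = #|[set y | connect (adj_in RE) u y]|.
  by rewrite /= card_sig cardsE.
rewrite /H1 /H2 !cU -/U1 -/U2.
have := cardsUI Um U2; rewrite path_cover_vertices path_meet_vertices cardsT cards1.
have x0U : x 0 \in U1 by rewrite inE connect0.
rewrite (card_chain_vertices (x := x) H1_path_new path_vertex_inj (leqnn m)).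
by rewrite /m; lia.
Qed.

End TreePath.

Lemma card_onesum (G1 G2 : mgraph) (w1 : vertex G1) (w2 : vertex G2) :
  (#|vertex (onesum w1 w2)| + 1 = #|vertex G1| + #|vertex G2|)%N.
Proof.
rewrite /= card_sum card_sig -addnA; congr addn.
by rewrite (cardC1 w2) addn1 prednK //; apply/card_gt0P; exists w2.
Qed.

(** * Non-negativity and the main identity *)

Definition nonneg_coefs (p : {poly int}) : Prop := forall i, 0 <= p`_i.

Lemma nonneg_coefsM p r :
  nonneg_coefs p -> nonneg_coefs r -> nonneg_coefs (p * r).
Proof.
by move=> p0 r0 i; rewrite coefM; apply: sumr_ge0 => j _; apply: mulr_ge0.
Qed.

Lemma nonneg_coefsX : nonneg_coefs 'X.
Proof. by move=> i; rewrite coefX ler0n. Qed.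

Lemma nonneg_coefs_tutte1 (G : mgraph) : nonneg_coefs (tutte1 G).
Proof.
have n1 : nonneg_coefs 1 by move=> i; rewrite coef1 ler0n.
rewrite /tutte1 /tutte; move: #|edge G| => n; elim: n G => [|n IH] G /=.
  by rewrite hornerC.
case: pickP => [e _|_]; last by rewrite hornerC.
case: ifP => _; first by rewrite hornerM hornerC; apply: nonneg_coefsM nonneg_coefsX _.
case: ifP => _; first by rewrite hornerM hornerX mul1r.
by move=> i; rewrite hornerD coefD addr_ge0 ?IH.
Qed.

Lemma nonneg_coefs_g (G : mgraph) (w : vertex G) : nonneg_coefs (g w).
Proof.
by rewrite /g; case: ifP => _; [apply: nonneg_coefs_tutte1 | move=> i; rewrite coef0].
Qed.

Theorem proposition3p2 (T : mgraph) (k : nat) (v : nat -> vertex T)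
    (hT : is_tree T) (hk : (2 <= k)%N) (hv : is_path k v)
    (hdeg : forall i : nat, (1 < i < k)%N -> degree (v i) = 2%N) :
  f T - f (tree_shift k v)
    = 'X * g (H1_root k v) * g (H2_root k v) * @g (path_graph k.-1) ord0
  /\ (forall i : nat, 0 <= (f T - f (tree_shift k v))`_i).
Proof.
suff E : f T - f (tree_shift k v)
    = 'X * g (H1_root k v) * g (H2_root k v) * @g (path_graph k.-1) ord0.
  split=> //; rewrite E -/(nonneg_coefs _).
  do !apply: nonneg_coefsM; by [apply: nonneg_coefsX | apply: nonneg_coefs_g].
have [e ex] := path_edge_exists hk hv.
pose q : {poly int} := 'X - 1.
have q0 : q != 0 by rewrite polyXsubC_eq0.
have cT := card_tree hT hk hv hdeg ex.
pose h1 := #|vertex (H1 k v)|; pose h2 := #|vertex (H2 k v)|.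
have cT' : (#|vertex (tree_shift k v)| = #|vertex T|)%N.
  have := card_onesum (H1_root k v) (H2_root k v).
  have := card_onesum (onesum_pt (H1_root k v) (H2_root k v)) (ord_max : vertex (path_graph k.-1)).
  by rewrite -/(tree_shift k v) [#|vertex (path_graph _)|]card_ord; lia.
(* q^(|V(T)| + 2) clears the powers of q in [f_rooted_cone], [g_rooted_cone] and
   [close_cone_tree_shift]. *)
apply: (mulfI (expf_neq0 (#|vertex T| + 2) q0)).
have fT := f_rooted_cone (v k).
have fT' := f_rooted_cone (onesum_pt (onesum_pt (H1_root k v) (H2_root k v)) (ord_max : vertex (path_graph k.-1))).
have gH1 := g_rooted_cone (H1_root k v).
have gH2 := g_rooted_cone (H2_root k v).
have gP := @g_rooted_cone (path_graph k.-1) ord0.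
rewrite -/q in fT fT' gH1 gH2 gP.
rewrite (rooted_cone_tree q hT hk hv hdeg ex) in fT.
rewrite !rooted_cone_onesum -/(tree_shift k v) cT' in fT'.
rewrite rooted_cone_path_rev rooted_cone_path in gP; last by lia.
rewrite rooted_cone_path in fT'; last by lia.
have := close_cone_tree_shift q k.-1 (rooted_cone q setT setT (H1_root k v))
  (rooted_cone q setT setT (H2_root k v)).
rewrite -fT -fT' -gH1 -gH2 -gP [#|vertex (path_graph _)|]card_ord.
rewrite -/h1 -/h2 prednK; last by lia.
have -> : 1 + q = 'X by rewrite /q addrC subrK.
clearbody q.
move=> main; rewrite [in RHS]cT !exprD -/h1 -/h2.
transitivity (q ^+ 2 * (q ^+ #|vertex T| * f T - q ^+ #|vertex T| * f (tree_shift k v))).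
  ring.
rewrite main; move: (g _) (g _) (g _) (q ^+ h1) (q ^+ h2) (q ^+ k) 'X.
move=> g1 g2 g3 q1 q2 q3 y; ring.
Qed.
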